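(* Let $(M,g,C)$ be a (possibly composite) elastic body with interface $N$ and density $\rho$, such that $P=L-\rho D_t^2$ is of real principal type. Then $Z_{\mathrm{out}}$ (at the boundary $\partial M\times\mathbb R$) and $Z^+_{\mathrm{out}}+Z^-_{\mathrm{out}}$ (at the interface $N\times\mathbb R$) are elliptic in the hyperbolic region $\mathcal H$.
   Context: Elastic body. $(M,g)$ is an oriented compact connected $3$-dimensional Riemannian manifold with smooth boundary $\partial M\neq\emptyset$; $N$ is a smooth orientable hypersurface (not necessarily connected) in the interior $M^\circ$, with two sides $N^\pm$; $M'=M^\circ\setminus N$, whose components extend as manifolds with smooth boundary. The stiffness tensor $C=(C^{ijkm})$ is real with $C^{ijkm}=C^{jikm}=C^{kmij}$ and positive definite on symmetric $2$-tensors; $\rho>0$; $C$ and $\rho$ are smooth except for possible jump discontinuities across $N$. $(Lu)^i=-(C^{ijkm}u_{k;m})_{;j}$ has principal symbol $\ell(\xi)=(C^{ijkm}\xi_j\xi_m)$, the traction is $(Tu)^i=C^{ijkm}u_{k;m}n_j$ with $n$ the exterior unit conormal. $P=L-\rho D_t^2$, $D_t=-i\partial_t$, has principal symbol $p(\xi,\tau)=\ell(\xi)-\rho\tau^2\mathrm{Id}$. $P$ is of real principal type: $\operatorname{Char}P=\{\det p=0\}\setminus0$ is a smooth hypersurface with non-radial Hamilton field homogeneous of degree zero, $\dim\ker p$ is locally constant on it, and $fp^{-1}$ extends smoothly across $\operatorname{Char}P$ for a defining function $f$. $H$ is the Hamilton field on $\operatorname{Char}P$ with $Ht=1$. Impedance.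 At $\partial M$, or at one side of $N$, let $r\ge0$ be the distance to the hypersurface (on that side), $\nu=dr$, and identify sections of $TM$ near the hypersurface with $r$-dependent sections of $TM$ restricted to it by parallel transport along normal geodesics. Let $D_r=-i\partial_r$. Then $iT=A_0D_r+A_1$ with $A_0,A_1$ tangential; for $\eta$ a covector of the hypersurface at $y$ the principal symbols are $a_0^{ik}=\nu_jC^{ijkm}\nu_m$, $a_1^{ik}=\nu_jC^{ijkm}\eta_m$, and put $a_2^{ik}=\eta_jC^{ijkm}\eta_m$. For $\gamma=(\eta,\tau)\ne0$ set $a(s)=p(\gamma+s\nu)=a_0s^2+(a_1+a_1^t)s+a_2-\rho\tau^2$, with values in $\operatorname{End}(\mathbb C\otimes T_yM)$. $\gamma$ is non-glancing if $Hr\ne0$ on $\operatorname{Char}P\cap(\gamma+\mathbb R\nu)$. The outgoing spectrum $\sigma_{\mathrm{out}}$ is the set of $s\in\mathbb C$ with $\operatorname{Im}s\ge0$, $\ker a(s)\neq0$, and $-\tau a'(s)$ positive definite on $\ker a(s)$ when $s$ is real. At non-glancing $\gamma$ there is a unique factorization $a(s)=(s-q^\sharp)a_0(s-q)$ with $\operatorname{spec}(q)=\sigma_{\mathrm{out}}$ and $\operatorname{spec}(q^\sharp)\cap\operatorname{spec}(q)=\emptyset$; write $q=q_{\mathrm{out}}$. Microlocally near non-glancing points $P\equiv(D_r-Q^\sharp)A_0(D_r-Q_{\mathrm{out}})$, with $Q_{\mathrm{out}}$ a tangential first order pseudo-differential operator with principal symbol $q_{\mathrm{out}}$, and the outgoing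 Dirichlet-to-Neumann operator is $Z_{\mathrm{out}}=-i(A_0Q_{\mathrm{out}}+A_1)|_{r=0}$, with principal symbol $z_{\mathrm{out}}=-i(a_0q_{\mathrm{out}}+a_1)$. $Z^\pm_{\mathrm{out}}$ denotes the corresponding operator for the side $N^\pm$. Hyperbolic region. $E$ (over $T^*(\partial M\times\mathbb R)$) and $E^\pm$ (over $T^*(N\times\mathbb R)$, sides $N^\pm$) are the rank $3$ bundles with fibers $\mathbb C\otimes T_yM$. Points of $T^*(N\times\mathbb R)\setminus0$ are non-glancing if they are so for both sides. $E=E_c\oplus E_r$, $E^\pm=E^\pm_c\oplus E^\pm_r$, where the subscripts $c$ and $r$ denote the sums of generalized eigenspaces of the respective $q_{\mathrm{out}}$ for eigenvalues with $\operatorname{Im}s>0$ and $s\in\mathbb R$. $\mathcal H$ is the set of non-glancing points where $E_c=0$ (at $\partial M$), respectively $E_c^+\cap E_c^-=0$ (at $N$). *)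

(* Defs.v *)
From HB Require Import structures.
From mathcomp Require Import all_boot all_order all_algebra.
From mathcomp Require Import complex.
From mathcomp Require Import all_classical all_reals all_analysis.

Set Implicit Arguments.
Unset Strict Implicit.
Unset Printing Implicit Defensive.

Import Order.TTheory GRing.Theory Num.Theory.
Import numFieldNormedType.Exports.

Local Open Scope classical_set_scope.
Local Open Scope ring_scope.
Local Open Scope complex_scope.

(* Conventions.  In a chart of the 3-manifold M, coordinate points, covectors
   (components xi_j) and contravariant vectors are row vectors of length 3,
   whereas the matrix of an endomorphism of (C (x) T_y M) with respect to the
   coordinate basis acts on columns.  Coordinate number 0 is the one transversal
   to the boundary and to the interface. *)

Section Smoothness.
Variables (R : realType) (V W : normedModType R).

(* C^oo on an open set U: every iterated directional derivative is (Frechet)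
   differentiable at every point of U. *)
Definition smooth_on (U : set V) (f : V -> W) : Prop :=
  forall (vs : seq V) (x : V), U x ->
    differentiable (foldr (fun v (g : V -> W) => ('D_v g : V -> W)) f vs) x.

Definition smooth_extension_at (K : set V) (f : V -> W) (x : V)
    (U : set V) (F : V -> W) : Prop :=
  [/\ open U, U x, smooth_on U F & {in U `&` K, F =1 f}].

(* C^oo on a set K that need not be open, e.g. up to the boundary. *)
Definition smooth_within (K : set V) (f : V -> W) : Prop :=
  forall x, K x -> exists U F, smooth_extension_at K f x U F.

End Smoothness.

Inductive chart_kind := Interior | Boundary | Interface.

Section CompositeManifold.
Variable R : realType.

(* Range of the charts of a given kind: an open subset of this set. *)
Definition chart_model (k : chart_kind) : set 'rV[R]_3 :=
  if k is Boundary then [set x | 0 <= x 0 0] else setT.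

(* The part of the model that lies on a given side of the interface, the
   interface itself included: true is the side N^+, false the side N^-.  Away
   from the interface the side is immaterial. *)
Definition side_model (k : chart_kind) (s : bool) : set 'rV[R]_3 :=
  match k with
  | Interior => setT
  | Boundary => [set x | 0 <= x 0 0]
  | Interface => if s then [set x | 0 <= x 0 0] else [set x | x 0 0 <= 0]
  end.

(* An oriented compact connected 3-manifold M with boundary bd, together with a
   hypersurface itf (the interface N) in its interior, described by an oriented
   atlas adapted to bd and itf. *)
Record composite_manifold := CompositeManifold {
  carrier : topologicalType;
  bd : set carrier;
  itf : set carrier;
  chart : Type;
  kind : chart -> chart_kind;
  dom : chart -> set carrier;
  crd : chart -> carrier -> 'rV[R]_3;
  par : chart -> 'rV[R]_3 -> carrier;
  carrier_hausdorff : hausdorff_space carrier;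
  carrier_compact : compact [set: carrier];
  carrier_connected : connected [set: carrier];
  bd_neq0 : bd !=set0;
  dom_cover : forall y, exists k, dom k y;
  dom_open : forall k, open (dom k);
  crd_open : forall k, exists2 O : set 'rV[R]_3, open O &
    crd k @` dom k = O `&` chart_model (kind k);
  crdK : forall k y, dom k y -> par k (crd k y) = y;
  crd_continuous : forall k, {within dom k, continuous (crd k)};
  par_continuous : forall k, {within crd k @` dom k, continuous (par k)};
  bdP : forall k y, dom k y ->
    bd y <-> kind k = Boundary /\ crd k y 0 0 = 0;
  itfP : forall k y, dom k y ->
    itf y <-> kind k = Interface /\ crd k y 0 0 = 0;
  transition_smooth : forall k l,
    smooth_within (crd k @` (dom k `&` dom l)) (crd l \o par k);
  transition_oriented : forall k l y U F, dom k y -> dom l y ->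
    smooth_extension_at (crd k @` (dom k `&` dom l)) (crd l \o par k)
      (crd k y) U F ->
    0 < \det ('J F (crd k y));
  (* The interface is co-oriented: the adapted charts agree, at its points, on
     which side is N^+. *)
  itf_cooriented : forall k l y U F, dom k y -> dom l y -> itf y ->
    smooth_extension_at (crd k @` (dom k `&` dom l)) (crd l \o par k)
      (crd k y) U F ->
    0 < 'J F (crd k y) 0 0
}.

(* J i a = d(crd l)_a / d(crd k)_i at y; at boundary points the derivatives are
   those of a smooth extension, on which they do not depend. *)
Definition transition_jacobian (M : composite_manifold) (k l : chart M)
    (y : carrier M) (J : 'M[R]_3) : Prop :=
  exists U F,
    smooth_extension_at (crd k @` (dom k `&` dom l)) (crd l \o par k)
      (crd k y) U F
    /\ J = 'J F (crd k y).

(* Coordinate range of the closure of one side of the composite manifold. *)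
Definition side_patch (M : composite_manifold) (k : chart M) (s : bool) :
    set 'rV[R]_3 := crd k @` dom k `&` side_model (kind k) s.

Definition tensor4 : Type := 'I_3 -> 'I_3 -> 'I_3 -> 'I_3 -> R.

End CompositeManifold.

Section ElasticBody.
Variable R : realType.

(* Coordinate representations of the metric g_{ij}, of the stiffness tensor
   C^{ijkm} and of the density rho.  stiff k s x and rho k s x are relevant for
   x in side_patch k s only; over the interface they are the one-sided limits
   from N^+ (s = true) and N^- (s = false), so that jumps are allowed there. *)
Record elastic_body := ElasticBody {
  body :> composite_manifold R;
  metric : chart body -> 'rV[R]_3 -> 'M[R]_3;
  stiff : chart body -> bool -> 'rV[R]_3 -> tensor4 R;
  rho : chart body -> bool -> 'rV[R]_3 -> R;
  metric_smooth : forall k, smooth_within (crd k @` dom k) (metric k);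
  metric_sym : forall k y, dom k y ->
    (metric k (crd k y))^T = metric k (crd k y);
  metric_gt0 : forall k y (v : 'rV[R]_3), dom k y -> v != 0 ->
    0 < (v *m metric k (crd k y) *m v^T) 0 0;
  metric_transform : forall k l y J, dom k y -> dom l y ->
    transition_jacobian k l y J ->
    metric k (crd k y) = J *m metric l (crd l y) *m J^T;
  stiff_smooth : forall k s i j p m,
    smooth_within (side_patch k s) (fun x => stiff k s x i j p m : R^o);
  stiff_sym : forall k s x i j p m, side_patch k s x ->
    stiff k s x i j p m = stiff k s x j i p m /\
    stiff k s x i j p m = stiff k s x p m i j;
  stiff_gt0 : forall k s x (e : 'M[R]_3), side_patch k s x ->
    e^T = e -> e != 0 ->
    0 < \sum_i \sum_j \sum_p \sum_m stiff k s x i j p m * e i j * e p m;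
  stiff_transform : forall k l s t y J, dom k y -> dom l y ->
    side_patch k s (crd k y) -> side_patch l t (crd l y) -> (itf y -> s = t) ->
    transition_jacobian k l y J ->
    forall a b c d, stiff l t (crd l y) a b c d =
      \sum_i \sum_j \sum_p \sum_m
        stiff k s (crd k y) i j p m * J i a * J j b * J p c * J m d;
  rho_smooth : forall k s, smooth_within (side_patch k s) (rho k s : _ -> R^o);
  rho_gt0 : forall k s x, side_patch k s x -> 0 < rho k s x;
  rho_transform : forall k l s t y, dom k y -> dom l y ->
    side_patch k s (crd k y) -> side_patch l t (crd l y) -> (itf y -> s = t) ->
    rho l t (crd l y) = rho k s (crd k y)
}.

End ElasticBody.

Section RealPrincipalType.
Variables (R : realType) (B : elastic_body R).

(* Points (x, t; xi, tau) of T^*(M x R) in local coordinates. *)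
Definition phase : Type := ('rV[R]_3 * R^o * 'rV[R]_3 * R^o)%type.

Definition ph_x (z : phase) : 'rV[R]_3 := z.1.1.1.
Definition ph_t (z : phase) : R := z.1.1.2.
Definition ph_xi (z : phase) : 'rV[R]_3 := z.1.2.
Definition ph_tau (z : phase) : R := z.2.

Definition ph_scale (c : R) (z : phase) : phase :=
  (ph_x z, ph_t z, c *: ph_xi z, c * ph_tau z).

Definition conic (W : set phase) : Prop :=
  forall c z, 0 < c -> W z -> W (ph_scale c z).

(* The matrix (alpha_j C^{ijkm} beta_m)_{ik}. *)
Definition double_contract (C : tensor4 R) (alpha beta : 'rV[R]_3) : 'M[R]_3 :=
  \matrix_(i, k) \sum_j \sum_m alpha 0 j * C i j k m * beta 0 m.

(* In the symbol C^{ijkm} xi_j xi_m of L the index k refers to the covariant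
   components of u; the right multiplication with the metric turns it into an
   endomorphism of the tangent space. *)
Definition symbol_L (k : chart B) (s : bool) (z : phase) : 'M[R]_3 :=
  double_contract (stiff k s (ph_x z)) (ph_xi z) (ph_xi z) *m metric k (ph_x z).

Definition symbol_P (k : chart B) (s : bool) (z : phase) : 'M[R]_3 :=
  symbol_L k s z - (rho k s (ph_x z) * ph_tau z ^+ 2)%:M.

(* T^*(M x R) \ 0 on the closure of one side of the body. *)
Definition cotangent (k : chart B) (s : bool) : set phase :=
  [set z | side_patch k s (ph_x z) /\ (ph_xi z, ph_tau z) <> (0, 0)].

Definition CharP (k : chart B) (s : bool) : set phase :=
  [set z | cotangent k s z /\ \det (symbol_P k s z) = 0].

Definition unit_row (i : 'I_3) : 'rV[R]_3 := delta_mx 0 i.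

Definition ham (f : phase -> R^o) (z : phase) : phase :=
  (\row_i 'D_((0, 0, unit_row i, 0) : phase) f z,
   'D_((0, 0, 0, 1) : phase) f z,
   - \row_i 'D_((unit_row i, 0, 0, 0) : phase) f z,
   - 'D_((0, 1, 0, 0) : phase) f z).

Definition radial (z : phase) : phase := (0, 0, ph_xi z, ph_tau z).

(* f is a defining function of Char P in the conic neighbourhood W of z0; being
   homogeneous of degree one, its Hamilton field is homogeneous of degree
   zero. *)
Definition defining_function (k : chart B) (s : bool) (z0 : phase)
    (W : set phase) (f : phase -> R^o) : Prop :=
  [/\ open W /\ conic W,
      W z0 /\ (forall z, W z -> (ph_xi z, ph_tau z) <> (0, 0)),
      smooth_on W f,
      (forall c z, 0 < c -> W z -> f (ph_scale c z) = c * f z)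
    & forall z, W z -> cotangent k s z ->
        (CharP k s z <-> f z = 0) /\
        (f z = 0 -> exists v : phase, 'D_v f z <> 0)].

Definition real_principal_type : Prop :=
  forall (k : chart B) (s : bool) (z0 : phase), CharP k s z0 ->
  exists (W : set phase) (f : phase -> R^o) (F : phase -> 'M[R]_3),
  [/\ defining_function k s z0 W f,
      (forall z, W z -> CharP k s z -> forall c : R,
         ham f z <> c *: radial z),
      (forall z, W z -> CharP k s z ->
         \rank (kermx (symbol_P k s z)) = \rank (kermx (symbol_P k s z0))),
      smooth_on W F
    & forall z, W z -> cotangent k s z -> ~ CharP k s z ->
        F z = f z *: invmx (symbol_P k s z)].

(* The value at z in Char P of the Hamilton field H with H t = 1. *)
Definition hamilton_vector (k : chart B) (s : bool) (z H : phase) : Prop :=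
  (exists W f c, defining_function k s z W f /\ H = c *: ham f z)
  /\ ph_t H = 1.

End RealPrincipalType.

Section Impedance.
Variables (R : realType) (B : elastic_body R).
Local Notation C := R[i].

Definition cplx (m n : nat) (A : 'M[R]_(m, n)) : 'M[C]_(m, n) :=
  map_mx (real_complex R) A.

(* nu = dr at the points x_0 = 0 of a chart adapted to the boundary (s = true)
   or to the interface, r being the distance to the hypersurface on side s: the
   unit conormal pointing into side s. *)
Definition conormal (k : chart B) (s : bool) (x : 'rV[R]_3) : 'rV[R]_3 :=
  ((-1) ^+ (~~ s) / Num.sqrt (invmx (metric k x) 0 0)) *: unit_row R 0.

(* T^*(bd x R) \ 0, resp. T^*(N x R) \ 0, in an adapted chart.  The normal
   geodesics identify a covector of the hypersurface with the covector of M
   which agrees with it on vectors tangent to the hypersurface and vanishes on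
   normal vectors, i.e. which is g-orthogonal to the conormal. *)
Definition hypersurface_cotangent (k : chart B) : set (phase R) :=
  [set z | [/\ kind k <> Interior,
               (crd k @` dom k) (ph_x z),
               ph_x z 0 0 = 0,
               (ph_xi z *m invmx (metric k (ph_x z)) *m
                  (conormal k true (ph_x z))^T) 0 0 = 0
             & (ph_xi z, ph_tau z) <> (0, 0)]].

Definition a0 (k : chart B) (s : bool) (z : phase R) : 'M[R]_3 :=
  double_contract (stiff k s (ph_x z)) (conormal k s (ph_x z))
    (conormal k s (ph_x z)) *m metric k (ph_x z).

Definition a1 (k : chart B) (s : bool) (z : phase R) : 'M[R]_3 :=
  double_contract (stiff k s (ph_x z)) (conormal k s (ph_x z)) (ph_xi z)
    *m metric k (ph_x z).

(* a_1^t: the transpose is taken of the bilinear form a_1^{ik}. *)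
Definition a1t (k : chart B) (s : bool) (z : phase R) : 'M[R]_3 :=
  (double_contract (stiff k s (ph_x z)) (conormal k s (ph_x z)) (ph_xi z))^T
    *m metric k (ph_x z).

Definition a2 (k : chart B) (s : bool) (z : phase R) : 'M[R]_3 :=
  double_contract (stiff k s (ph_x z)) (ph_xi z) (ph_xi z) *m metric k (ph_x z).

(* a(w) = p(gamma + w nu), for complex w, and its derivative a'(w). *)
Definition apoly (k : chart B) (s : bool) (z : phase R) (w : C) : 'M[C]_3 :=
  w ^+ 2 *: cplx (a0 k s z) + w *: cplx (a1 k s z + a1t k s z)
  + cplx (a2 k s z - (rho k s (ph_x z) * ph_tau z ^+ 2)%:M).

Definition apoly' (k : chart B) (s : bool) (z : phase R) (w : C) : 'M[C]_3 :=
  (2 * w) *: cplx (a0 k s z) + cplx (a1 k s z + a1t k s z).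

Definition ph_shift (k : chart B) (s : bool) (z : phase R) (w : R) : phase R :=
  (ph_x z, ph_t z, ph_xi z + w *: conormal k s (ph_x z), ph_tau z).

(* H r <> 0 on Char P \cap (gamma + R nu), where H r = <dr, H> = <nu, H>. *)
Definition nonglancing (k : chart B) (s : bool) (z : phase R) : Prop :=
  forall w : R, CharP k s (ph_shift k s z w) ->
  forall H : phase R, hamilton_vector k s (ph_shift k s z w) H ->
    (conormal k s (ph_x z) *m (ph_x H)^T) 0 0 <> 0.

(* The Hermitian form (A v, v) for the inner product given by the metric. *)
Definition hform (k : chart B) (z : phase R) (A : 'M[C]_3) (v : 'cV[C]_3) : C :=
  ((map_mx Num.conj v)^T *m cplx (metric k (ph_x z)) *m A *m v) 0 0.

Definition sigma_out (k : chart B) (s : bool) (z : phase R) : set C :=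
  [set w : C | [/\ 0 <= complex.Im w,
     exists2 v : 'cV[C]_3, v != 0 & apoly k s z w *m v = 0
   & complex.Im w = 0 -> forall v : 'cV[C]_3, v != 0 ->
       apoly k s z w *m v = 0 ->
       0 < hform k z (- (ph_tau z)%:C *: apoly' k s z w) v]].

(* eigenvalue refers to row vectors, which gives the same spectrum. *)
Definition spec (q : 'M[C]_3) : set C := [set w | eigenvalue q w].

(* q = q_out, the right factor in a(s) = (s - q^#) a_0 (s - q). *)
Definition is_q_out (k : chart B) (s : bool) (z : phase R) (q : 'M[C]_3) :
    Prop :=
  spec q = sigma_out k s z /\
  exists qs : 'M[C]_3, spec qs `&` spec q = set0 /\
    forall w : C, apoly k s z w =
      (w%:M - qs) *m cplx (a0 k s z) *m (w%:M - q).

(* Principal symbol of Z_out = -i (A_0 Q_out + A_1) at r = 0, given that of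
   Q_out. *)
Definition z_out (k : chart B) (s : bool) (z : phase R) (q : 'M[C]_3) :
    'M[C]_3 :=
  - 'i *: (cplx (a0 k s z) *m q + cplx (a1 k s z)).

Definition gen_eigenspace (q : 'M[C]_3) (w : C) : set 'cV[C]_3 :=
  [set v | exists n : nat, (q - w%:M) ^+ n *m v = 0].

Definition E_c (q : 'M[C]_3) : set 'cV[C]_3 :=
  [set v | exists l : seq (C * 'cV[C]_3),
     (forall p, p \in l -> 0 < complex.Im p.1 /\ gen_eigenspace q p.1 p.2) /\
     v = \sum_(p <- l) p.2].

(* Non-glancing points over the boundary, resp. over the interface. *)
Definition nonglancing_bd (k : chart B) : set (phase R) :=
  [set z | [/\ kind k = Boundary, hypersurface_cotangent k z
             & nonglancing k true z]].

Definition nonglancing_itf (k : chart B) : set (phase R) :=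
  [set z | [/\ kind k = Interface, hypersurface_cotangent k z
             & forall s, nonglancing k s z]].

(* The hyperbolic region H; q, resp. q s on side s, is q_out as a function on
   the non-glancing points. *)
Definition hyperbolic_bd (k : chart B) (q : phase R -> 'M[C]_3) :
    set (phase R) :=
  [set z | nonglancing_bd k z /\ E_c (q z) = [set 0]].

Definition hyperbolic_itf (k : chart B) (q : bool -> phase R -> 'M[C]_3) :
    set (phase R) :=
  [set z | nonglancing_itf k z /\
           E_c (q true z) `&` E_c (q false z) = [set 0]].

(* Ellipticity, in a set of covectors, of a pseudo-differential operator with
   matrix valued principal symbol sigma. *)
Definition elliptic_in (S : set (phase R)) (sigma : phase R -> 'M[C]_3) :
    Prop :=
  forall z, S z -> sigma z \in unitmx.

End Impedance.

(* Main.v *)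
(* Let q = q_out, let G be the metric and F = G a_0 q + (G a_0 q)^* + G (a_1 +
   a_1^t), so that the energy flux v^* F v is twice the real part of i v^* G z_out v.
   The factorization of a(s) gives a_0 q^2 + (a_1 + a_1^t) q + (a_2 - rho tau^2)
   = 0, hence F q = q^* F, and generalized eigenspaces of q for eigenvalues a, b
   are F-orthogonal unless a is the conjugate of b.  As spec q lies in the closed
   upper half plane, only the real eigenvalues contribute to v^* F v.  There F
   restricts to a'(s) on ker a(s), so the outgoing condition makes -tau F definite
   (and excludes Jordan blocks).  Therefore -tau F >= 0, and v^* F v = 0 only for
   v in E_c.  If z_out v = 0, or (z_out^+ + z_out^-) v = 0, then the fluxes add
   up to zero, so v lies in E_c, respectively in the intersection of E_c^+ and
   E_c^-. *)

Require Import Defs.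
From mathcomp Require Import all_boot all_order all_algebra.
From mathcomp Require Import complex.
From mathcomp Require Import all_classical all_reals all_analysis.

Set Implicit Arguments.
Unset Strict Implicit.
Unset Printing Implicit Defensive.

Import Order.TTheory GRing.Theory Num.Theory.

Local Open Scope ring_scope.

(** * Generalized eigenvectors and primary decomposition *)

Section GeneralizedEigenvectors.
Variables (F : fieldType) (n : nat) (q : 'M[F]_n.+1).

Definition gen_eigenvector (a : F) (v : 'cV[F]_n.+1) : Prop :=
  exists m : nat, (q - a%:M) ^+ m *m v = 0.

Lemma eigenvalue_unitmx (a : F) : eigenvalue q a = (q - a%:M \notin unitmx).
Proof. by rewrite /eigenvalue /eigenspace kermx_eq0 row_free_unit. Qed.

Lemma eigenvalue_col (a : F) (v : 'cV[F]_n.+1) :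
  v != 0 -> q *m v = a *: v -> eigenvalue q a.
Proof.
move=> v0 hv; rewrite eigenvalue_unitmx; apply: contra v0 => qU.
by rewrite -(mulKmx qU v) mulmxBl hv mul_scalar_mx subrr mulmx0.
Qed.

Lemma gen_eigenvector_eq0 (a : F) (v : 'cV[F]_n.+1) :
  ~~ eigenvalue q a -> gen_eigenvector a v -> v = 0.
Proof.
rewrite eigenvalue_unitmx negbK => qU [m hv].
by rewrite -(mulKmx (unitrX m qU) v) hv mulmx0.
Qed.

(* [q - b] is invertible on the generalized eigenspace of [a <> b]: on it
   [(b - a)^-1 ((q - a) - (q - b))] is the identity, and the first term lowers
   the order of nilpotency. *)
Lemma gen_eigenvector_solve (a b : F) (m : nat) (v : 'cV[F]_n.+1) :
  a != b -> (q - a%:M) ^+ m *m v = 0 ->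
  exists2 w, (q - a%:M) ^+ m *m w = 0 & v = (q - b%:M) *m w.
Proof.
move=> ab; elim: m v => [|m IHm] v hv.
  exists 0; first by rewrite mulmx0.
  by move: hv; rewrite expr0 mul1mx mulmx0.
have [w hw ew] : exists2 w, (q - a%:M) ^+ m *m w = 0
    & (q - a%:M) *m v = (q - b%:M) *m w.
  by apply: IHm; rewrite mulmxA -[_ *m (q - _)]exprSr.
exists ((b - a)^-1 *: (w - v)).
  rewrite -scalemxAr mulmxBr hv exprS -[_ * _]/(_ *m _) -mulmxA hw.
  by rewrite mulmx0 subr0 scaler0.
rewrite -scalemxAr mulmxBr -ew -mulmxBl opprB [X in X *m _]addrC addrA subrK.
rewrite -raddfB /= mul_scalar_mx scalerA mulVf ?scale1r //.
by rewrite subr_eq0 eq_sym.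
Qed.

Lemma gen_eigenvector_solveX (a b : F) (k : nat) (v : 'cV[F]_n.+1) :
  a != b -> gen_eigenvector a v -> exists w, v = (q - b%:M) ^+ k *m w.
Proof.
move=> ab [m]; elim: k v => [|k IHk] v hv; first by exists v; rewrite mul1mx.
have [u /IHk[w ->] ->] := gen_eigenvector_solve ab hv.
by exists w; rewrite exprS -mulmxA.
Qed.

(** Induction on the factors: decompose [(q - b) v] and pull its components for [a != b] back
    through [q - b]. The index list [S] stays fixed and duplicate-free, so that repeated roots in
    [s] feed a single summand. *)
Lemma gen_eigenvector_decomp (S s : seq F) (v : 'cV[F]_n.+1) :
  uniq S -> {subset s <= S} -> \prod_(a <- s) (q - a%:M) *m v = 0 ->
  exists2 f : F -> 'cV[F]_n.+1, forall a, gen_eigenvector a (f a)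
    & v = \sum_(a <- S) f a.
Proof.
move=> uS; elim: s v => [|b s IHs] v sS.
  rewrite big_nil mul1mx => ->; exists (fun=> 0); last by rewrite big1.
  by move=> a; exists 0%N; rewrite mulmx0.
have bS : b \in S by apply: sS; rewrite mem_head.
rewrite big_cons -[_ * _]/(_ *m _).
have -> : (q - b%:M) *m \prod_(a <- s) (q - a%:M) =
    \prod_(a <- s) (q - a%:M) *m (q - b%:M).
  rewrite -[_ *m _]/(_ * _); apply: commr_prod => a _.
  apply: commrB; last exact: comm_mx_scalar.
  by apply/commr_sym/commrB => //; exact: comm_mx_scalar.
rewrite -mulmxA => /IHs[|f fg ef]; first by move=> a sa; rewrite sS // inE sa orbT.
have /choice[g gP] : forall a, exists w, a != b ->
    gen_eigenvector a w /\ f a = (q - b%:M) *m w.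
  move=> a; have [->|ab] := eqVneq a b; first by exists 0.
  have [m fm] := fg a; have [w wm ew] := gen_eigenvector_solve ab fm.
  by exists w => _; split=> //; exists m.
(* The remainder [vb] is sent by [q - b] to [f b], hence is a generalized eigenvector for [b], of
   order one higher. *)
pose vb := v - \sum_(a <- S | a != b) g a.
have evb : (q - b%:M) *m vb = f b.
  rewrite mulmxBr ef (bigD1_seq b) //= mulmx_sumr -addrA -sumrB big1 ?addr0 //.
  by move=> a ab; have [_ ->] := gP a ab; rewrite subrr.
exists (fun a => if a == b then vb else g a).
  move=> a; have [->|ab] := eqVneq a b; last by case: (gP a ab).
  have [m fm] := fg b; exists m.+1.
  by rewrite exprSr -mulmxA evb.
rewrite (bigD1_seq b) //= eqxx.
by under eq_bigr => a /negPf-> do []; rewrite subrK.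
Qed.

End GeneralizedEigenvectors.

(** By Cayley-Hamilton, the split characteristic polynomial supplies the annihilating product. *)
Lemma gen_eigenvector_decomp_closed (F : closedFieldType) (n : nat)
    (q : 'M[F]_n.+1) (v : 'cV[F]_n.+1) :
  exists2 S : seq F, uniq S & exists2 f : F -> 'cV[F]_n.+1,
    forall a, gen_eigenvector q a (f a) & v = \sum_(a <- S) f a.
Proof.
have [s es] := closed_field_poly_normal (char_poly q).
exists (undup s); first exact: undup_uniq.
apply: (@gen_eigenvector_decomp _ _ _ _ s); first exact: undup_uniq.
  by move=> a; rewrite mem_undup.
have := Cayley_Hamilton q; rewrite es (monicP (char_poly_monic q)) scale1r.
rewrite rmorph_prod /=; under eq_bigr => a _.
  rewrite rmorphB /= horner_mx_X horner_mx_C; over.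
by move->; rewrite mul0mx.
Qed.

(** * Matrices self-adjoint for a possibly indefinite form *)

Section Adjoint.
Variable C : numClosedFieldType.

Definition adjmx (m p : nat) (A : 'M[C]_(m, p)) : 'M[C]_(p, m) :=
  (map_mx Num.conj A)^T.

Lemma adjmxK m p (A : 'M[C]_(m, p)) : adjmx (adjmx A) = A.
Proof. by apply/matrixP => i j; rewrite !mxE conjCK. Qed.

Lemma adjmxM m p r (A : 'M[C]_(m, p)) (B : 'M[C]_(p, r)) :
  adjmx (A *m B) = adjmx B *m adjmx A.
Proof. by rewrite /adjmx map_mxM trmx_mul. Qed.

Lemma adjmxD m p (A B : 'M[C]_(m, p)) : adjmx (A + B) = adjmx A + adjmx B.
Proof. by rewrite /adjmx map_mxD linearD. Qed.

Lemma adjmxZ m p a (A : 'M[C]_(m, p)) : adjmx (a *: A) = a^* *: adjmx A.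
Proof. by rewrite /adjmx map_mxZ linearZ. Qed.

Lemma adjmx_sum m p I (r : seq I) (E : I -> 'M[C]_(m, p)) :
  adjmx (\sum_(i <- r) E i) = \sum_(i <- r) adjmx (E i).
Proof. by rewrite /adjmx raddf_sum raddf_sum. Qed.

Variables (n : nat) (q K : 'M[C]_n.+1).
Hypothesis q_selfadjoint : K *m q = adjmx q *m K.

Lemma selfadjoint_shiftX (b : C) (k : nat) :
  K *m (q - b%:M) ^+ k = adjmx ((q - b^*%:M) ^+ k) *m K.
Proof.
have shift : K *m (q - b%:M) = adjmx (q - b^*%:M) *m K.
  rewrite /adjmx map_mxB map_scalar_mx /= conjCK [(_ - _)^T]raddfB /=.
  by rewrite tr_scalar_mx mulmxBr q_selfadjoint mulmxBl mul_mx_scalar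
    mul_scalar_mx.
elim: k => [|k IHk].
  by rewrite /adjmx !expr0 map_mx1 trmx1 mulmx1 mul1mx.
rewrite exprSr exprS -[_ * _]/(_ *m _) mulmxA IHk -mulmxA shift.
by rewrite mulmxA -adjmxM.
Qed.

Lemma gen_eigenvector_orthogonal (a b : C) (x y : 'cV[C]_n.+1) :
  gen_eigenvector q a x -> gen_eigenvector q b y -> a != b^* ->
  adjmx x *m K *m y = 0.
Proof.
move=> xa [k yk] ab; have [w ->] := gen_eigenvector_solveX k ab xa.
by rewrite adjmxM -(mulmxA (adjmx w)) -selfadjoint_shiftX -!mulmxA yk !mulmx0.
Qed.

(** Abstract form of a spectrum in the closed upper half plane: no two distinct eigenvalues are
    conjugate. *)
Hypothesis spec_conj : forall a b,
  eigenvalue q a -> eigenvalue q b -> a = b^* -> a = b.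
Hypothesis real_definite : forall a (v : 'cV[C]_n.+1),
  a^* = a -> v != 0 -> q *m v = a *: v -> 0 < (adjmx v *m K *m v) 0 0.

(* If [(q - a) v = u] is an eigenvector, then [u^* K u = ((q - a) u)^* K v = 0],
   against definiteness. *)
Lemma real_gen_eigenvector (a : C) (v : 'cV[C]_n.+1) :
  a^* = a -> gen_eigenvector q a v -> q *m v = a *: v.
Proof.
move=> aR; suff ker_shift (m : nat) (u : 'cV[C]_n.+1) :
    (q - a%:M) ^+ m *m u = 0 -> (q - a%:M) *m u = 0.
  move=> [m /ker_shift/eqP].
  by rewrite mulmxBl mul_scalar_mx subr_eq0 => /eqP.
elim: m u => [|m IHm] u; first by rewrite mul1mx => ->; rewrite mulmx0.
rewrite exprSr -mulmxA => /IHm; set w := _ *m u => hw.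
apply/eqP/negPn/negP => w0.
have hKw : adjmx w *m K *m w = 0.
  have := selfadjoint_shiftX a 1; rewrite !expr1 aR => hK.
  rewrite {2}/w -mulmxA (mulmxA K) hK !mulmxA -adjmxM hw.
  by rewrite /adjmx map_mx0 trmx0 !mul0mx.
have : 0 < (adjmx w *m K *m w) 0 0.
  apply: (real_definite aR w0).
  by apply/eqP; rewrite -subr_eq0 -mul_scalar_mx -mulmxBl hw.
by rewrite hKw mxE ltxx.
Qed.

(** Cross terms vanish because distinct eigenvalues are not conjugate, and a component for a nonreal
    eigenvalue is isotropic. The form is thus a sum over real eigenvalues, each nonzero component
    contributing positively. *)
Lemma selfadjoint_form_ge0 (v : 'cV[C]_n.+1) :
  0 <= (adjmx v *m K *m v) 0 0 /\
  ((adjmx v *m K *m v) 0 0 = 0 ->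
   exists (S : seq C) (f : C -> 'cV[C]_n.+1), v = \sum_(a <- S) f a /\
     forall a, a \in S ->
       [/\ eigenvalue q a, a^* != a & gen_eigenvector q a (f a)]).
Proof.
have [S uS [f fg ev]] := gen_eigenvector_decomp_closed q v.
pose e a := (adjmx (f a) *m K *m f a) 0 0.
have spec_f a : f a != 0 -> eigenvalue q a.
  by apply: contraR => /gen_eigenvector_eq0/(_ (fg a))->.
have e_gt0 a : a^* = a -> f a != 0 -> 0 < e a.
  by move=> aR f0; apply: (real_definite aR f0); exact: real_gen_eigenvector.
have e_ge0 a : 0 <= e a.
  have [f0|f0] := eqVneq (f a) 0; first by rewrite /e f0 mulmx0 mxE.
  have [aR|aN] := eqVneq a^* a; first exact/ltW/e_gt0.
  by rewrite /e (gen_eigenvector_orthogonal (fg a) (fg a)) ?mxE // eq_sym.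
have form_sum : (adjmx v *m K *m v) 0 0 = \sum_(a <- S) e a.
  rewrite {1}ev adjmx_sum !mulmx_suml summxE; apply: eq_big_seq => a aS.
  rewrite {1}ev mulmx_sumr summxE (bigD1_seq a) //= big1 ?addr0 // => b ba.
  have [fa0|fa0] := eqVneq (f a) 0.
    by rewrite fa0 /adjmx map_mx0 trmx0 !mul0mx mxE.
  have [fb0|fb0] := eqVneq (f b) 0; first by rewrite fb0 mulmx0 mxE.
  rewrite (gen_eigenvector_orthogonal (fg a) (fg b)) ?mxE //.
  apply: contraNneq ba => ab.
  by rewrite (spec_conj (spec_f _ fa0) (spec_f _ fb0) ab).
rewrite form_sum; split; first exact: sumr_ge0.
move/eqP; rewrite psumr_eq0 // => /allP eS0.
(* Only an index with nonzero component is known to be an eigenvalue. *)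
exists [seq a <- S | f a != 0], f; split.
  rewrite big_filter ev (bigID (fun a => f a == 0)) /= big1 ?add0r //.
  by move=> a /eqP.
move=> a; rewrite mem_filter => /andP[fa0 /eS0/= ea0]; split=> //.
  exact: spec_f.
by apply: contraTneq ea0 => aR; rewrite gt_eqF // e_gt0.
Qed.

End Adjoint.

Lemma col_kernel_unitmx (F : fieldType) (n : nat) (A : 'M[F]_n) :
  (forall v : 'cV[F]_n, A *m v = 0 -> v = 0) -> A \in unitmx.
Proof.
move=> inj; rewrite -unitmx_tr unitmxE unitfE; apply/negP => /det0P[v v0 hv].
by case/eqP: v0; apply: trmx_inj; rewrite trmx0; apply: inj;
  rewrite -[A]trmxK -trmx_mul hv trmx0.
Qed.

(** * Quadratic matrix polynomials and the energy flux *)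

Section Flux.
Variable (C : numClosedFieldType) (n : nat).

(** The values at [w = 0] and [w = 1] already give [a2 = qs a0 q] and [b = - a0 q - qs a0]. *)
Lemma right_root (a0 b a2 q qs : 'M[C]_n) :
  (forall w : C, w ^+ 2 *: a0 + w *: b + a2 =
     (w%:M - qs) *m a0 *m (w%:M - q)) ->
  a0 *m q *m q + b *m q + a2 = 0.
Proof.
move=> fact; have := fact 0.
rewrite expr0n !scale0r !add0r raddf0 !sub0r mulNmx mulmxN mulNmx opprK => e2.
have := fact 1; rewrite expr1n !scale1r mulmxBl mul1mx !mulmxBr !mulmxBl.
rewrite !mulmx1 -e2 => e1.
have -> : b = - (a0 *m q) - qs *m a0.
  apply: (addrI a0); apply: (addIr a2); rewrite e1.
  rewrite opprB [LHS]addrA [LHS]addrAC; congr (_ + a2).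
  by rewrite -addrA [- _ - _]addrC.
by rewrite mulmxBl mulNmx e2 addrA addrN sub0r addNr.
Qed.

(* [K = s0 q + q^* s0 + b] is the energy flux of [u = exp(i r q) v] through the
   hypersurface; [K q = q^* K] says that it does not depend on [r]. *)
Definition flux (s0 b q : 'M[C]_n) : 'M[C]_n := s0 *m q + adjmx q *m s0 + b.

(** The root equation reduces [flux * q] to [q^* s0 q - s2], which is Hermitian, as is the flux
    itself. *)
Lemma flux_selfadjoint (s0 b s2 q : 'M[C]_n) :
  adjmx s0 = s0 -> adjmx b = b -> adjmx s2 = s2 ->
  s0 *m q *m q + b *m q + s2 = 0 ->
  flux s0 b q *m q = adjmx q *m flux s0 b q.
Proof.
move=> h0 hb h2 root.
have e : flux s0 b q *m q = adjmx q *m s0 *m q - s2.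
  apply/eqP; rewrite -subr_eq0 opprB; apply/eqP; rewrite -[RHS]root.
  rewrite /flux !mulmxDl [_ + _ *m q]addrAC -!addrA; congr (_ + (_ + _)).
  by rewrite addrCA subrr addr0.
have hK : adjmx (flux s0 b q) = flux s0 b q.
  by rewrite /flux !adjmxD !adjmxM adjmxK h0 hb [_ *m q + _]addrC.
rewrite -[in RHS]hK -adjmxM e; apply: (addIr (adjmx s2)).
by rewrite -adjmxD {1}h2 !subrK !adjmxM adjmxK h0 mulmxA.
Qed.

End Flux.

(** * Outgoing impedance of the elastic body *)

Section Body.
Variables (R : realType) (B : elastic_body R).
Implicit Types (k : chart B) (s : bool) (z : phase R).

Lemma hypersurface_side_patch k s z :
  hypersurface_cotangent k z -> side_patch k s (ph_x z).
Proof.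
move=> [_ xk x0 _ _]; split => //.
by case: (kind k); [exact: I | |case: s]; rewrite /side_model /mkset x0.
Qed.

Lemma metric_trmx k z :
  hypersurface_cotangent k z -> (metric k (ph_x z))^T = metric k (ph_x z).
Proof. by move=> [_ [y ky <-] _ _ _]; exact: Defs.metric_sym. Qed.

Lemma double_contract_trmx k s x (u : 'rV[R]_3) : side_patch k s x ->
  (double_contract (stiff k s x) u u)^T = double_contract (stiff k s x) u u.
Proof.
move=> xs; apply/matrixP => i j; rewrite !mxE exchange_big /=.
apply: eq_bigr => p _; apply: eq_bigr => m _.
by rewrite (stiff_sym j m i p xs).2 [LHS]mulrAC [RHS]mulrAC [u 0 m * _]mulrC.
Qed.

Lemma adjmx_cplx m p (A : 'M[R]_(m, p)) : adjmx (cplx A) = cplx A^T.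
Proof. by apply/matrixP => i j; rewrite !mxE; exact: conjc_real. Qed.

(** Lowering an index by the metric makes the symbols sesquilinear forms, whose adjoint is the
    transpose of the contravariant matrix. *)
Lemma sesqui_cplx m (g A : 'M[R]_m) : g^T = g ->
  adjmx (cplx g *m cplx (A *m g)) = cplx g *m cplx (A^T *m g).
Proof.
by move=> gT; rewrite /cplx -!map_mxM adjmx_cplx !trmx_mul gT mulmxA.
Qed.

Lemma hformD k z (A A' : 'M[R[i]]_3) v :
  hform k z (A + A') v = hform k z A v + hform k z A' v.
Proof. by rewrite /hform mulmxDr mulmxDl mxE. Qed.

Lemma conj_fixed_Im (w : R[i]) : w^* = w <-> complex.Im w = 0.
Proof.
case: w => a b /=; split=> [[/eqP]|->]; last by rewrite /Num.conj /= oppr0.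
by rewrite eq_sym -addr_eq0 -mulr2n mulrn_eq0 => /eqP.
Qed.

Section Point.
Variables (k : chart B) (s : bool) (z : phase R) (q : 'M[R[i]]_3).
Hypothesis hz : hypersurface_cotangent k z.
Hypothesis hq : is_q_out k s z q.

Let G := cplx (metric k (ph_x z)).
Let tau : R[i] := (- (ph_tau z)%:C)%C.
Let b := cplx (a1 k s z + a1t k s z).
(** The factor [tau], minus the time frequency, gives the flux the sign of the outgoing
    condition. *)
Let K := tau *: flux (G *m cplx (a0 k s z)) (G *m b) q.

Let a0_adj : adjmx (G *m cplx (a0 k s z)) = G *m cplx (a0 k s z).
Proof.
rewrite sesqui_cplx ?metric_trmx // double_contract_trmx //.
exact: hypersurface_side_patch.
Qed.

Let a1_adj : adjmx (G *m cplx (a1 k s z)) = G *m cplx (a1t k s z).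
Proof. by rewrite sesqui_cplx ?metric_trmx. Qed.

Let bE : G *m b = G *m cplx (a1 k s z) + adjmx (G *m cplx (a1 k s z)).
Proof. by rewrite a1_adj -mulmxDr; congr (G *m _); exact: map_mxD. Qed.

Let K_selfadjoint : K *m q = adjmx q *m K.
Proof.
have gT := metric_trmx hz; have xs := hypersurface_side_patch s hz.
have [_ [qs [_ fact]]] := hq.
rewrite /K -scalemxAl -scalemxAr; congr (_ *: _).
apply: (flux_selfadjoint (s2 := G *m
  cplx (a2 k s z - (rho k s (ph_x z) * ph_tau z ^+ 2)%:M))).
- exact: a0_adj.
- by rewrite bE adjmxD adjmxK addrC.
- rewrite /cplx -map_mxM adjmx_cplx trmx_mul gT linearB /= trmx_mul gT.
  rewrite double_contract_trmx // tr_scalar_mx mulmxBl mulmxBr mulmxA.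
  by rewrite scalar_mxC.
- by rewrite -!mulmxA -!mulmxDr !mulmxA (right_root fact) mulmx0.
Qed.

Let spec_out w : eigenvalue q w -> sigma_out k s z w.
Proof. by case: hq => <-. Qed.

Let spec_conj a c : eigenvalue q a -> eigenvalue q c -> a = c^* -> a = c.
Proof.
move=> /spec_out[+ _ _] /spec_out[+ _ _] ac; rewrite ac.
case: c {ac} => x y /=; rewrite oppr_ge0 => y0 y1.
by apply/conj_fixed_Im/eqP; rewrite eq_le y0 y1.
Qed.

Let real_definite a (v : 'cV[R[i]]_3) :
  a^* = a -> v != 0 -> q *m v = a *: v -> 0 < (adjmx v *m K *m v) 0 0.
Proof.
move=> aR v0 qv; have [_ [qs [_ fact]]] := hq.
have [_ _ pos] := spec_out (eigenvalue_col v0 qv).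
have av : apoly k s z a *m v = 0.
  by rewrite fact -mulmxA [_ *m v]mulmxBl mul_scalar_mx qv subrr mulmx0.
have := pos ((conj_fixed_Im a).1 aR) v v0 av; rewrite /hform -/G -/tau.
rewrite -[(map_mx _ v)^T]/(adjmx v).
suff -> : adjmx v *m G *m (tau *: apoly' k s z a) *m v = adjmx v *m K *m v by [].
rewrite /K /flux -!scalemxAr -!scalemxAl; congr (_ *: _).
(* For real [a] with [q v = a v], both terms of the flux with [a0] give [a] times the form of [a0],
   matching [2 a a0] in [a'(a)]. *)
rewrite /apoly' -/b !mulmxDr !mulmxDl !mulmxA; congr (_ + _).
rewrite -[in RHS]adjmxM -[X in X + _]mulmxA qv adjmxZ aR.
by rewrite -!scalemxAl -!scalemxAr -scalerDl -mulr2n mulr_natl -scalemxAl.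
Qed.

Let flux_form v :
  let h := 'i%C * hform k z (z_out k s z q) v in
  (adjmx v *m K *m v) 0 0 = tau * (h + h^*).
Proof.
move=> h; rewrite {}/h.
pose X := G *m cplx (a0 k s z) *m q + G *m cplx (a1 k s z).
have XD : X = G *m (cplx (a0 k s z) *m q + cplx (a1 k s z)).
  by rewrite mulmxDr mulmxA.
have XE : flux (G *m cplx (a0 k s z)) (G *m b) q = X + adjmx X.
  by rewrite /X adjmxD adjmxM a0_adj bE /flux addrACA.
have -> : 'i%C * hform k z (z_out k s z q) v = (adjmx v *m X *m v) 0 0.
  (* The factor ['i] cancels the [- 'i] in [z_out]. *)
  rewrite /hform /z_out -/G -scalemxAr -scalemxAl mxE mulrA.
  by rewrite mulrN -expr2 sqr_i opprK mul1r XD mulmxA.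
have -> : ((adjmx v *m X *m v) 0 0)^* = (adjmx v *m adjmx X *m v) 0 0.
  have -> : adjmx v *m adjmx X *m v = adjmx (adjmx v *m X *m v).
    by rewrite adjmxM [adjmx (_ *m X)]adjmxM adjmxK mulmxA.
  by rewrite [RHS]mxE [RHS]mxE.
by rewrite /K XE -scalemxAr -scalemxAl mxE mulmxDr mulmxDl [X in _ * X]mxE.
Qed.

Lemma z_out_form v :
  let h := 'i%C * hform k z (z_out k s z q) v in
  0 <= tau * (h + h^*) /\ (tau * (h + h^*) = 0 -> E_c q v).
Proof.
move=> h; rewrite -flux_form.
have [K0 KE] := selfadjoint_form_ge0 K_selfadjoint spec_conj real_definite v.
split=> // /KE[S [f [-> fS]]]; exists [seq (a, f a) | a <- S]; split.
  move=> _ /mapP[a aS ->] /=; have [/spec_out[a0 _ _] aN fa] := fS a aS.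
  split=> //; rewrite lt_neqAle a0 andbT eq_sym.
  by apply: contra aN => /eqP/conj_fixed_Im->.
by rewrite big_map.
Qed.
End Point.
End Body.

(** * Ellipticity at the boundary and at the interface *)

Theorem proposition8p1 (R : realType) (B : elastic_body R)
    (hP : real_principal_type B) :
  (forall (k : chart B) (q : phase R -> 'M[R[i]%C]_3),
     (forall z, nonglancing_bd k z -> is_q_out k true z (q z)) ->
     elliptic_in (hyperbolic_bd k q) (fun z => z_out k true z (q z)))
  /\
  (forall (k : chart B) (q : bool -> phase R -> 'M[R[i]%C]_3),
     (forall z, nonglancing_itf k z -> forall s, is_q_out k s z (q s z)) ->
     elliptic_in (hyperbolic_itf k q)
       (fun z => z_out k true z (q true z) + z_out k false z (q false z))).
Proof.
have hform0 k (z : phase R) (A : 'M[R[i]]_3) v : A *m v = 0 -> hform k z A v = 0.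
  by move=> Av; rewrite /hform -mulmxA Av mulmx0 mxE.
split=> k q hq z [ng Ec0]; apply: col_kernel_unitmx => v zv.
  have [_ hz _] := ng; have [_ Ec] := z_out_form hz (hq z ng) v.
  have : E_c (q z) v by apply: Ec; rewrite hform0 // mulr0 conjC0 addr0 mulr0.
  by rewrite Ec0.
have [_ hz _] := ng.
have /eqP := hform0 B k z _ v zv; rewrite hformD addr_eq0 => /eqP hpm.
(* Both sides share the metric and [tau], so their fluxes are opposite; being both nonnegative, they
   vanish. *)
have := z_out_form hz (hq z ng true) v; have := z_out_form hz (hq z ng false) v.
cbv zeta; rewrite hpm mulrN rmorphN /= -opprD mulrN.
move=> [e0 Em]; rewrite oppr_ge0 => -[e0' Ep].
have e_eq0 := le_anti (introT andP (conj e0' e0)).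
have : (E_c (q true z) `&` E_c (q false z))%classic v.
  by split; [apply: Ep; rewrite e_eq0 oppr0|apply: Em].
by rewrite Ec0.
Qed.
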